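(* Let $c_*=\dfrac{1}{40000000010006048640}$. For every prime $p$, every set $A\subseteq \mathbb Z/p\mathbb Z$ with $|A|\ge 2$ and no unique sum satisfies $$|A|\ge c_*\,\log p\,\log\log p .$$ Consequently, $m(p)\gg \log p\,\log\log p$, i.e. there is an absolute constant $c>0$ such that $m(p)\ge c\,\log p\,\log\log p$ for every odd prime $p$.
   Context: All logarithms are natural. For an abelian group $G$ and $A\subseteq G$, the set $A$ has no unique sum if for all $a,b\in A$ there are $c,d\in A$ with $a+b=c+d$ and not ($(a=c$ and $b=d)$ or $(a=d$ and $b=c)$); i.e. no element of $A+A$ has exactly one representation as the sum of an unordered pair (two-element multiset, repetition allowed) of elements of $A$. For a prime $p\ge 3$, $m(p)$ is the minimum of $|A|$ over all $A\subseteq\mathbb Z/p\mathbb Z$ with $|A|\ge 2$ having no unique sum (this minimum exists). *)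

(* Defs.v *)
From mathcomp Require Import all_boot all_order all_algebra.
From mathcomp Require Import boolp reals exp.
From mathcomp Require Import zify.

Set Implicit Arguments.
Unset Strict Implicit.
Unset Printing Implicit Defensive.

Import Order.TTheory GRing.Theory Num.Theory.
Local Open Scope ring_scope.

Definition no_unique_sum (G : zmodType) (A : {pred G}) : Prop :=
  forall a b : G, a \in A -> b \in A ->
  exists c d : G, [/\ c \in A, d \in A, a + b = c + d
                    & ~ ((a = c /\ b = d) \/ (a = d /\ b = c))].

Definition admissible (p : nat) (A : {set 'Z_p}) : Prop :=
  (2 <= #|A|)%N /\ no_unique_sum A.

(* The seed [set: 'Z_p] of the arg min is itself admissible for p >= 3, so that
   this is the minimal cardinality (lemma m_minimum); it carries no meaning for
   p < 3, where no admissible set exists. *)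
Definition m (p : nat) : nat :=
  #|[arg min_(A < [set: 'Z_p] | `[< admissible A >]) #|A|]|.

(* The denominator is 40 000 000 010 006 048 640, split because a numeral in
   a ring is elaborated to a unary natural. *)
Definition c_star (R : realType) : R :=
  1 / (40 * 10 ^+ 18 + 10 * 10 ^+ 9 + 6 * 10 ^+ 6 + 48 * 10 ^+ 3 + 640).

Lemma setT_admissible (p : nat) : (2 < p)%N -> admissible [set: 'Z_p].
Proof.
move=> p3; have p1 : (1 < p)%N by lia.
split; first by rewrite cardsT card_ord Zp_cast.
have nz k : (0 < k < p)%N -> (k%:R : 'Z_p) != 0.
  move=> kp; apply/eqP => /(congr1 val) /=.
  by rewrite val_Zp_nat // modn_small; lia.
have n1 : (1 : 'Z_p) != 0 by exact: oner_neq0.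
have n2 : (1 + 1 : 'Z_p) != 0 by apply: (nz 2%N); lia.
have n1' (x : 'Z_p) : x <> x + 1.
  by move/eqP; rewrite -subr_eq0 opprD addNKr oppr_eq0 (negPf n1).
move=> a b _ _; case: (eqVneq a (b - 1)) => [ab|ab].
- exists (a - 1), (b + 1); split; rewrite ?inE //.
    by rewrite addrACA addNr addr0.
  move=> [] [e1 e2]; first exact: n1' e2.
  have : (b + 1) - (b - 1) == 0 by rewrite subr_eq0 -e1 ab.
  by rewrite opprB addrAC addrCA addrA addrK (negPf n2).
- exists (a + 1), (b - 1); split; rewrite ?inE //.
    by rewrite addrACA subrr addr0.
  move=> [] [e1 e2]; first exact: n1' e1.
  by rewrite e1 eqxx in ab.
Qed.

Lemma m_minimum (p : nat) : (2 < p)%N ->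
  (exists2 A : {set 'Z_p}, admissible A & #|A| = m p) /\
  (forall A : {set 'Z_p}, admissible A -> (m p <= #|A|)%N).
Proof.
move=> p3; rewrite /m; case: arg_minnP => [|A /asboolP PA minA].
  by apply/asboolP; exact: setT_admissible.
by split=> [|B PB]; [exists A | apply: minA; apply/asboolP].
Qed.

(* Main.v *)
(* Replacing A by a minimal subset without unique sums, the equations
   a + b = c + d have only constant rational solutions on A, since the maximum
   level set of a solution again has no unique sum.  Hence if every element of A
   is an integer combination, with coefficients of l1-norm at most L, of N
   generators, then the equations rewritten in the generators have full rank over
   the rationals but not modulo p: some nonzero minor is divisible by p, and
   p <= (4 L)^N.  Taking A itself as generators gives p <= 4^n with n = |A|; the
   task is to find O(n / q) generators with L = O(q), where q = (log_2 n)^2.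

   Colour the group randomly with q colours.  The least frequent colour class D
   in A satisfies, with positive probability, both of the following: every
   difference t with many disjoint representations t = d - b is a difference of
   D (such t are "popular"), and every a with many disjoint representations
   a = c + d - b lies in D + D - D (such a are "good").  If a is bad, a small set
   meets all its representations, and this forces: for almost every b in A there
   is h <> a with a - h popular and b + a - h in A.

   Join a to h when a - h is popular.  An element whose ball of radius q has more
   than q elements is within distance 2 q of one of n / q centres.  Otherwise
   its ball is a small set C closed under the relation.  If every such C contains
   a good element, D and the centres generate.  If some C is entirely bad,
   Dirichlet's theorem embeds a dilate of C in a short interval; let a be its
   maximum.  Steps b -> b + a - h with h in C always increase, so they cannot stay
   within a small set, and every small closed set contains one of the few
   exceptional b.  The same domination argument then shows that C, the exceptional
   elements and the centres generate. *)
Require Import Defs.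
From mathcomp Require Import all_boot all_order all_algebra.
From mathcomp Require Import boolp reals exp.
From mathcomp Require Import all_fingroup.
From mathcomp Require Import zify ring lra.

Set Implicit Arguments.
Unset Strict Implicit.
Unset Printing Implicit Defensive.

Import Order.TTheory GRing.Theory Num.Theory.

(** * Elementary inequalities *)

Lemma expn_succ_lower (a m : nat) : a ^ m * (a + m) <= a * a.+1 ^ m.
Proof.
elim: m => [|m IH]; first by rewrite !expn0 mul1n addn0 muln1.
rewrite (expnS a.+1) mulnCA.
apply: leq_trans (leq_mul (leqnn a.+1) IH).
rewrite expnS; move: (a ^ m) => x; nia.
Qed.

(** Bernoulli's inequality [expn_succ_lower], with exponent [q], gives [(1 - 1/q)^q <= 1/2]. *)
Lemma exp_pred_double (q w : nat) :
  0 < q -> 2 ^ w * (q - 1) ^ (q * w) <= q ^ (q * w).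
Proof.
case: q => // a _; rewrite subn1 /= !expnM -expnMn.
have le : 2 * a ^ a.+1 <= a.+1 ^ a.+1.
  case: a => [|a]; first by [].
  have := expn_succ_lower a.+1 a.+2.
  rewrite -[_ <= a.+2 ^ _](leq_pmul2l (ltn0Sn a)).
  move: (a.+1 ^ _) (a.+2 ^ _) => x y; nia.
by case: w => [|w]; rewrite ?expn0 // leq_exp2r.
Qed.

Lemma card_bigcup_le_sum (T I : finType) (P : pred I) (F : I -> {set T}) :
  #|\bigcup_(i | P i) F i| <= \sum_(i | P i) #|F i|.
Proof.
apply: (big_ind2 (fun (X : {set T}) n => #|X| <= n)) => [|X m Y n Xm Yn|//].
  by rewrite cards0.
exact: leq_trans (leq_card_setU _ _) (leq_add Xm Yn).
Qed.

(** * Dense colour classes *)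

Section Triples.
Variable T : finType.
Implicit Types (t u : T * T * T) (A D H : {set T}).

Definition supp t : {set T} := [set t.1.1; t.1.2; t.2].

Definition packing (F : pred (T * T * T)) (M : nat) : Prop :=
  exists s : seq (T * T * T),
    [/\ size s = M, all F s & pairwise (fun t u => [disjoint supp t & supp u]) s].

Lemma card_supp t : #|supp t| <= 3.
Proof.
rewrite /supp; apply: leq_trans (leq_card_setU _ _) _.
by rewrite cards1 addn1 ltnS cards2; case: eqP.
Qed.

(** Greedy choice: either some triple misses the supports chosen so far and extends the packing, or
    the union of these supports meets every triple of [F]. *)
Lemma packing_or_cover F M :
  packing F M \/
  exists H, #|H| <= 3 * M /\ forall t, F t -> ~~ [disjoint supp t & H].
Proof.
elim: M => [|M [[s [<- Fs ps]]|[H [cH HF]]]]; first by left; exists [::].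
- pose H := \bigcup_(t <- s) supp t.
  have cH : #|H| <= 3 * size s.
    rewrite /H; elim: {Fs ps H} s => [|t s IH]; first by rewrite big_nil cards0.
    rewrite big_cons mulnS; apply: leq_trans (leq_card_setU _ _) _.
    exact: leq_add (card_supp t) IH.
  case: (pickP (fun t => F t && [disjoint supp t & H])) => [t /andP[Ft dt]|no].
  + left; exists (t :: s); split => //=; first by rewrite Ft.
    rewrite ps andbT; apply/allP => u us; apply: disjointWr dt.
    by rewrite /H (big_rem u) //= subsetUl.
  + right; exists H; split; first by apply: leq_trans cH _; rewrite leq_mul2l leqnSn.
    by move=> t Ft; move: (no t); rewrite Ft /= => ->.
- right; exists H; split=> //; apply: leq_trans cH _.
  by rewrite leq_mul2l leqnSn.
Qed.

Section Colourings.
Variable q : nat.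
Implicit Types (c : 'I_q) (X : {ffun T -> 'I_q}).

Definition mono c X t := [&& X t.1.1 == c, X t.1.2 == c & X t.2 == c].

Definition avoiders c s := [set X | all (fun t => ~~ mono c X t) s].

(** For a uniform random colouring, disjoint supports make the events [mono c X t] independent, each
    of probability at least [1 / q^3]; here denominators are cleared. *)
Lemma card_avoiders c (s : seq (T * T * T)) :
  pairwise (fun t u => [disjoint supp t & supp u]) s ->
  #|avoiders c s| * (q ^ 3) ^ size s <= (q ^ 3 - 1) ^ size s * q ^ #|T|.
Proof.
elim: s => [|t s IH] /=.
  by rewrite !expn0 muln1 mul1n -[q in q ^ _]card_ord -card_ffun max_card.
case/andP=> /allP dt /IH {}IH.
pose Y := [set X in avoiders c s | mono c X t].
have cardY : #|avoiders c (t :: s)| + #|Y| = #|avoiders c s|.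
  rewrite -(cardsID [set X | mono c X t] (avoiders c s)) addnC; congr (_ + _).
    by apply: eq_card => X; rewrite !inE.
  by apply: eq_card => X; rewrite !inE /= andbC andbC.
(* Recolouring [supp t] with [c] while recording the three old colours is injective, and maps the
   avoiders of [s] into [Y] times the [q ^ 3] records. *)
pose recolour X := [ffun x => if x \in supp t then c else X x].
pose code X := (recolour X, (X t.1.1, X t.1.2, X t.2)).
have code_inj : injective code.
  move=> X X' [/ffunP e e1 e2 e3]; apply/ffunP => x.
  move: (e x); rewrite !ffunE; case: ifP => // + _.
  by rewrite !inE => /orP[/orP[]|] /eqP ->.
have le : #|avoiders c s| <= #|Y| * q ^ 3.
  have -> : #|Y| * q ^ 3 = #|setX Y [set: 'I_q * 'I_q * 'I_q]|.
    by rewrite cardsX cardsT !card_prod !card_ord !expnS expn0 muln1 !mulnA.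
  rewrite -(card_imset _ code_inj); apply: subset_leq_card.
  apply/subsetP => _ /imsetP[X XA ->]; rewrite in_setX in_setT andbT /=.
  move: XA; rewrite inE => /allP XA.
  rewrite inE /mono; apply/andP; split; last by rewrite !ffunE !inE !eqxx ?orbT !eqxx.
  rewrite inE; apply/allP => u us; have := XA u us; apply: contra.
  have out x : x \in supp u -> recolour X x = X x.
    by move=> xu; rewrite ffunE (disjointFl (dt u us) xu).
  by rewrite /mono !out // !inE eqxx ?orbT.
have step : #|avoiders c (t :: s)| * q ^ 3 <= #|avoiders c s| * (q ^ 3 - 1).
  by rewrite -cardY mulnBr mulnDl muln1; lia.
move: (q ^ 3) step IH => Q step IH; rewrite !expnS.
rewrite mulnA; apply: leq_trans (leq_mul step (leqnn _)) _.
by rewrite mulnAC [leqLHS]mulnC -mulnA leq_mul2l IH orbT.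
Qed.

End Colourings.

(** A union bound over the [q * #|J|] pairs of a colour and an index yields one colouring that
    serves every index in every colour at once, so the rarest colour on [A] can be picked
    afterwards. *)
Lemma exists_dense_colour_class (A : {set T}) (I : finType) (J : {set I})
    (F : I -> pred (T * T * T)) (q M : nat) :
  0 < q -> q * #|J| * (q ^ 3 - 1) ^ M < (q ^ 3) ^ M ->
  (forall i t, F i t -> supp t \subset A) ->
  (forall i, i \in J -> packing (F i) M) ->
  exists D : {set T}, q * #|D| <= #|A| /\
    forall i, i \in J -> exists t, F i t /\ supp t \subset D.
Proof.
move=> q0 small FA FJ.
pose bad (ci : 'I_q * I) : {set {ffun T -> 'I_q}} :=
  [set X | [forall t, F ci.2 t ==> ~~ mono ci.1 X t]].
pose P := setX [set: 'I_q] J.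
have bad1 ci : ci \in P -> #|bad ci| * (q ^ 3) ^ M <= (q ^ 3 - 1) ^ M * q ^ #|T|.
  rewrite inE => /andP[_ /FJ[s [<- Fs ps]]].
  apply: leq_trans (card_avoiders ci.1 ps); rewrite leq_mul2r; apply/orP; right.
  apply: subset_leq_card; apply/subsetP => X; rewrite !inE => /forallP bX.
  by apply/allP => t /(allP Fs) Ft; apply: implyP (bX t) Ft.
have [X noX] : exists X : {ffun T -> 'I_q}, forall ci, ci \in P -> X \notin bad ci.
  pose B := \bigcup_(ci in P) bad ci.
  have le : #|B| * (q ^ 3) ^ M <= #|P| * ((q ^ 3 - 1) ^ M * q ^ #|T|).
    have sum1 : \sum_(ci in P) #|bad ci| * (q ^ 3) ^ M
        <= \sum_(ci in P) (q ^ 3 - 1) ^ M * q ^ #|T|.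
      by apply: leq_sum => ci; exact: bad1.
    rewrite -[leqRHS]sum_nat_const; apply: leq_trans sum1.
    rewrite -big_distrl /= leq_mul2r; apply/orP; right.
    exact: card_bigcup_le_sum.
  have : #|B| < #|{ffun T -> 'I_q}|.
    rewrite card_ffun card_ord -(ltn_pmul2r (m := (q ^ 3) ^ M)); last first.
      by rewrite !expn_gt0 q0.
    apply: leq_ltn_trans le _; rewrite cardsX cardsT card_ord mulnA.
    by rewrite [ltnRHS]mulnC ltn_pmul2r // expn_gt0 q0.
  rewrite -cardsT -subn_gt0 => lt.
  have [X] : exists X, X \in ~: B.
    by apply/set0Pn; rewrite -card_gt0 cardsCs setCK -cardsT.
  rewrite inE => XB; exists X => ci ciP; apply: contra XB => Xb.
  by apply/bigcupP; exists ci.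
have [c cle] : exists c : 'I_q, q * #|[set x in A | X x == c]| <= #|A|.
  apply/existsP; rewrite -[X in is_true X]negbK negb_exists; apply/negP => /forallP gt.
  have : \sum_(c : 'I_q) q * #|[set x in A | X x == c]| = q * #|A|.
    rewrite -big_distrr /=; congr (_ * _).
    rewrite -sum1_card (partition_big X predT) //=; apply: eq_bigr => c _.
    by rewrite -sum1_card; apply: eq_bigl => x; rewrite inE.
  have : \sum_(c : 'I_q) #|A|.+1 <= \sum_(c : 'I_q) q * #|[set x in A | X x == c]|.
    by apply: leq_sum => c _; rewrite ltnNge.
  by move=> + e; rewrite e sum_nat_const card_ord leq_pmul2l // ltnn.
exists [set x in A | X x == c]; split => // i iJ.
have := noX (c, i); rewrite inE in_setT iJ inE => /(_ isT).
rewrite negb_forall => /existsP[t]; rewrite negb_imply negbK => /andP[Ft mt].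
exists t; split => //; apply/subsetP => x xt.
rewrite inE (subsetP (FA _ _ Ft)) //=.
by move: xt mt; rewrite !inE => /orP[/orP[]|] /eqP -> /and3P[].
Qed.

End Triples.

(** * Domination by balls *)

Section Balls.
Variables (T : finType) (e : rel T) (A : {set T}).

Definition ball (k : nat) (x : T) : {set T} :=
  iter k (fun X => X :|: [set y in A | [exists z in X, e z y]]) [set x].

Definition out_closed (C : {set T}) :=
  forall x y, x \in C -> y \in A -> e x y -> y \in C.

Lemma ball_refl k x : x \in ball k x.
Proof. by elim: k => [|k IH] /=; rewrite inE // IH. Qed.

Lemma ball_sub k x : x \in A -> ball k x \subset A.
Proof.
move=> xA; elim: k => [|k IH] /=; first by rewrite sub1set.
by rewrite subUset IH; apply/subsetP => y; rewrite inE => /andP[].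
Qed.

(** Each step either adds a point or stalls at a closed set. *)
Lemma ball_closed_or_large k x : out_closed (ball k x) \/ k < #|ball k x|.
Proof.
elim: k => [|k IH] /=; first by right; rewrite cards1.
set X := ball k x in IH *; set N := [set y in A | _].
case: (boolP (N \subset X)) => [NX|].
  left; rewrite (setUidPl NX) => y z yX zA yz; apply: (subsetP NX).
  by rewrite inE zA; apply/existsP; exists y; rewrite yX.
case: IH => [cX /subsetPn[y]|ltX nN].
  by rewrite inE => /andP[yA /existsP[z /andP[zX zy]]]; rewrite (cX z y).
right; apply: leq_ltn_trans ltX _; apply: proper_card.
by rewrite properE subsetUl subUset subxx.
Qed.

(** [Z] is a maximal set of centres whose balls are pairwise disjoint and have at least [k] points;
    disjointness bounds [#|Z|]. By maximality a ball with more than [k] points meets the ball of a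
    centre; any other ball is closed and contains a point of [Y]. *)
Lemma dominating_set (k : nat) (Y : {set T}) :
  (forall C : {set T}, C \subset A -> C != set0 -> #|C| <= k -> out_closed C ->
     exists2 y, y \in C & y \in Y) ->
  exists Z : {set T}, [/\ Z \subset A, k * #|Z| <= #|A| &
    forall a, a \in A -> exists2 y, y \in ball k a &
      y \in Y \/ exists2 z, z \in Z & y \in ball k z].
Proof.
move=> small.
pose P (Z : {set T}) := (Z \subset A) &&
  [forall z in Z, (k <= #|ball k z|) &&
     [forall z' in Z, (z != z') ==> [disjoint ball k z & ball k z']]].
have P0 : P set0.
  by rewrite /P sub0set; apply/forallP => z; rewrite inE.
have [Z /maxsetP[/andP[ZA /forallP PZ] maxZ] _] := maxset_exists P0.
have PZk z : z \in Z -> k <= #|ball k z|.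
  by move=> zZ; have := PZ z; rewrite zZ => /andP[].
have PZd z z' : z \in Z -> z' \in Z -> z != z' -> [disjoint ball k z & ball k z'].
  move=> zZ zZ' ne; have := PZ z; rewrite zZ => /andP[_ /forallP/(_ z')].
  by rewrite zZ' ne.
exists Z; split => //.
- have : \sum_(z in Z) #|ball k z| <= #|A|.
    have -> : \sum_(z in Z) #|ball k z|
        = \sum_(x in A) \sum_(z in Z | x \in ball k z) 1.
      rewrite (exchange_big_dep (mem Z)) /=; last by move=> ? ? _ /andP[].
      apply: eq_bigr => z zZ; rewrite -sum1_card; apply: eq_bigl => x.
      rewrite zZ /= andb_idl // => xz.
      by rewrite (subsetP (ball_sub k (subsetP ZA z zZ))).
    rewrite -sum1_card; apply: leq_sum => x _.
    rewrite sum1_card; apply/card_le1_eqP => z z' /andP[zZ xz] /andP[zZ' xz'].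
    apply/eqP; apply: contraT => ne.
    by move: xz; rewrite (disjointFr (PZd _ _ zZ' zZ ne) xz').
  by apply: leq_trans; rewrite mulnC -sum_nat_const; apply: leq_sum.
- move=> a aA; case: (leqP #|ball k a| k) => [le|/ltnW lt].
    have cl : out_closed (ball k a).
      by case: (ball_closed_or_large k a) => //; rewrite ltnNge le.
    have ne : ball k a != set0 by apply/set0Pn; exists a; exact: ball_refl.
    have [y ya yY] := small _ (ball_sub k aA) ne le cl.
    by exists y => //; left.
  case: (pickP (fun z => (z \in Z) && ~~ [disjoint ball k a & ball k z])).
    move=> z /andP[zZ]; rewrite -setI_eq0 => /set0Pn[y /setIP[ya yz]].
    by exists y => //; right; exists z.
  move=> none; have dis z : z \in Z -> [disjoint ball k a & ball k z].
    by move=> zZ; move: (none z); rewrite zZ /= => /negbFE.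
  have PU : P (a |: Z).
    rewrite /P subUset sub1set aA ZA /=; apply/forallP => z; apply/implyP => zU.
    apply/andP; split; first by case/setU1P: zU => [->|/PZk].
    apply/forallP => z'; apply/implyP => zU'; apply/implyP => ne.
    case/setU1P: zU ne => [->|zZ]; case/setU1P: zU' => [->|zZ'] ne.
    - by rewrite eqxx in ne.
    - exact: dis.
    - by rewrite disjoint_sym dis.
    - exact: PZd.
  have aZ : a \in Z by rewrite -(maxZ _ PU (subsetUr _ _)) setU11.
  exists a; first exact: ball_refl.
  by right; exists a => //; exact: ball_refl.
Qed.

End Balls.

Local Open Scope ring_scope.

(** * Bounding p by a determinant *)

(** The expanded product has one term for each function from rows to columns; the Leibniz formula
    retains the permutations. *)
Lemma det_le_prod_row_sums (R : numDomainType) (n : nat) (M : 'M[R]_n) :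
  `|\det M| <= \prod_i \sum_j `|M i j|.
Proof.
rewrite /determinant bigA_distr_bigA /=.
apply: le_trans (ler_norm_sum _ _ _) _.
rewrite (eq_bigr (fun s : {perm 'I_n} => \prod_i `|M i (s i)|)); last first.
  by move=> s _; rewrite normrM normrX normrN1 expr1n mul1r normr_prod.
pose f (s : {perm 'I_n}) : {ffun 'I_n -> 'I_n} := [ffun i => s i].
have f_inj : injective f.
  by move=> s t /ffunP e; apply/permP => i; move: (e i); rewrite !ffunE.
rewrite (eq_bigr (fun s => \prod_i `|M i (f s i)|)); last first.
  by move=> s _; apply: eq_bigr => i _; rewrite ffunE.
rewrite -(big_imset (fun g : {ffun 'I_n -> 'I_n} => \prod_i `|M i (g i)|)) /=; last first.
  by move=> s t _ _; exact: f_inj.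
rewrite [leRHS](bigID (mem (f @: {perm 'I_n}))) /= lerDl.
by apply: sumr_ge0 => g _; apply: prodr_ge0.
Qed.

(** Cramer's rule on a nonsingular minor [S] of maximal size, with [D] its determinant. *)
Lemma int_multiple_in_row_span (m n B : nat) (M : 'M[int]_(m, n)) (u : 'rV[int]_n) :
  (0 < B)%N ->
  (forall i, \sum_j `|M i j| <= B%:Z) ->
  (map_mx intr u <= (map_mx intr M : 'M[rat]_(m, n)))%MS ->
  exists (D : int) (y : 'rV[int]_m),
    [/\ D != 0, (`|D| <= B ^ n)%N & D *: u = y *m M].
Proof.
move=> B0 rowB; set MQ := map_mx _ M => uM.
pose r : nat := \rank MQ.
pose f : 'I_r -> 'I_m := maxrankfun MQ.
pose M1 := rowsub f MQ.
have full : row_full M1^T by rewrite /row_full mxrank_tr; exact: maxrowsub_free.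
pose g : 'I_r -> 'I_n := fullrankfun full.
pose S := mxsub f g M.
have SQ : map_mx intr S = (rowsub g M1^T)^T.
  by rewrite map_mxsub trmx_mxsub trmxK /M1 /MQ -mxsub_comp.
have detS : \det S != 0.
  rewrite -(intr_eq0 rat) -det_map_mx SQ det_tr -unitfE -unitmxE.
  exact: fullrowsub_unit.
have [x ux] : exists x : 'rV_r, map_mx intr u = x *m M1.
  by apply/submxP; rewrite /M1 eq_maxrowsub.
(* On the columns [g], [u = x M1] reads [u_g = x S], so [det S * x = u_g * adj S] is integral; the
   last factor places these coefficients on the rows [f]. *)
exists (\det S), (colsub g u *m \adj S *m rowsub f 1%:M); split => //.
- rewrite -lez_nat abszE.
  apply: le_trans (det_le_prod_row_sums S) _.
  have le1 (i : 'I_r) : 0 <= \sum_j `|S i j| <= B%:Z.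
    rewrite sumr_ge0 //=; apply: le_trans (rowB (f i)).
    have g_inj : injective g by exact: fullrankfun_inj.
    rewrite (eq_bigr (fun j => `|M (f i) (g j)|)); last by move=> j _; rewrite mxE.
    rewrite -(big_imset (fun j => `|M (f i) j|)) /=; last by move=> j k _ _; exact: g_inj.
    by rewrite [leRHS](bigID (mem (g @: 'I_r))) /= lerDl sumr_ge0.
  apply: (@le_trans _ _ (\prod_(i < r) B%:Z)); first by apply: ler_prod => i _; exact: le1.
  rewrite prodr_const card_ord -[B%:Z]natz -natrX natz lez_nat.
  by rewrite leq_pexp2l // rank_leq_col.
- rewrite -mulmxA -rowsubE.
  have eqQ : map_mx (intr : int -> rat) (\det S *: u)
      = map_mx intr (colsub g u *m \adj S *m rowsub f M).
    rewrite map_mxZ !map_mxM map_mx_adj map_mxsub ux -mulmx_colsub.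
    have -> : colsub g M1 = map_mx intr S.
      by rewrite /S map_mxsub /M1 -mxsub_comp.
    rewrite -(mulmxA x) mul_mx_adj mul_mx_scalar -scalemxAl det_map_mx.
    by rewrite map_mxsub.
  apply/rowP => j; apply: (intr_inj (R := rat)).
  by have := congr1 (fun X : 'rV[rat]_n => X 0 j) eqQ; rewrite [LHS]mxE [RHS]mxE.
Qed.

Lemma Zp_mulrn_eq0 (p : nat) (x : 'Z_p) (n : nat) :
  prime p -> x *+ n = 0 -> x != 0 -> (p %| n)%N.
Proof.
move=> pr; have p1 := prime_gt1 pr; rewrite Zp_mulrn => /(congr1 val) /= e x0.
have : (p %| x * n)%N by rewrite /dvdn -[p in (_ %% p)%N]Zp_cast // e.
rewrite Euclid_dvdM // => /orP[|//].
have xp : (x < p)%N by rewrite -[ltnRHS](Zp_cast p1) ltn_ord.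
by rewrite gtnNdvd // lt0n; apply: contra x0 => /eqP x0; apply/eqP/val_inj.
Qed.

Lemma Zp_mulrz_eq0 (p : nat) (x : 'Z_p) (z : int) :
  prime p -> x *~ z = 0 -> x != 0 -> (p %| `|z|)%N.
Proof.
move=> pr; case: z => n; first by exact: Zp_mulrn_eq0.
by rewrite NegzE mulrNz => /eqP; rewrite oppr_eq0 abszN => /eqP; exact: Zp_mulrn_eq0.
Qed.

(** * Integer combinations of generators *)

Section Combinations.
Variable G : finZmodType.
Implicit Types (S A : {set G}) (x y : G).

Definition combination S (L : nat) x : Prop :=
  exists v : G -> int, (\sum_(g in S) `|v g| <= L)%N /\ \sum_(g in S) g *~ v g = x.

Lemma combination_gen S x : x \in S -> combination S 1 x.
Proof.
move=> xS; exists (fun g => (g == x)%:Z); split.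
  rewrite (bigD1 x) //= eqxx big1 // => g /andP[_ /negPf -> //].
rewrite (bigD1 x) //= eqxx mulr1z big1 ?addr0 // => g /andP[_ /negPf ->].
by rewrite mulr0z.
Qed.

Lemma combinationD S L K x y :
  combination S L x -> combination S K y -> combination S (L + K) (x + y).
Proof.
move=> [v [vL <-]] [w [wK <-]]; exists (fun g => v g + w g); split.
  apply: leq_trans (leq_add vL wK); rewrite -big_split /=.
  by apply: leq_sum => g _; lia.
by rewrite -big_split /=; apply: eq_bigr => g _; rewrite mulrzDr.
Qed.

Lemma combinationN S L x : combination S L x -> combination S L (- x).
Proof.
move=> [v [vL <-]]; exists (fun g => - v g); split.
  by under eq_bigr => g _ do rewrite abszN.
by rewrite -sumrN; apply: eq_bigr => g _; rewrite mulrNz.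
Qed.

Lemma combinationB S L K x y :
  combination S L x -> combination S K y -> combination S (L + K) (x - y).
Proof. by move=> cx /combinationN; exact: combinationD. Qed.

Lemma combination_le S L K x : (L <= K)%N -> combination S L x -> combination S K x.
Proof. by move=> LK [v [vL e]]; exists v; split=> //; exact: leq_trans LK. Qed.

Lemma combination_subset S S' L x :
  S \subset S' -> combination S L x -> combination S' L x.
Proof.
move=> SS [v [vL <-]]; exists (fun g => if g \in S then v g else 0); split.
  apply: leq_trans vL; rewrite (big_setID S) /= (setIidPr SS).
  rewrite [X in (_ + X)%N]big1 ?addn0; last by move=> g /setDP[_ /negPf ->].
  by apply: leq_sum => g ->.
rewrite (big_setID S) /= (setIidPr SS) [X in _ + X]big1 ?addr0.
  by apply: eq_bigr => g ->.
by move=> g /setDP[_ /negPf ->]; rewrite mulr0z.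
Qed.

Lemma combination_ball S A (e : rel G) (L k : nat) x y :
  (forall x y, e x y -> combination S L (y - x)) ->
  y \in ball e A k x -> combination S (k * L) (y - x).
Proof.
move=> eL; elim: k y => [|k IH] y /=.
  rewrite inE => /eqP ->; rewrite subrr; exists (fun=> 0); split.
    by rewrite big1.
  by rewrite big1 // => g _; rewrite mulr0z.
rewrite inE => /orP[/IH|]; first by apply: combination_le; rewrite leq_mul2r leqnSn orbT.
rewrite inE => /andP[_ /existsP[z /andP[/IH cz /eL cy]]].
by rewrite -(subrKA z) mulSn; exact: combinationD.
Qed.

End Combinations.

(** * Minimal sets without unique sums *)

Definition minimal_no_unique_sum (G : finZmodType) (A : {set G}) : Prop :=
  [/\ (2 <= #|A|)%N, no_unique_sum A &
      forall B : {set G}, B \subset A -> (2 <= #|B|)%N -> no_unique_sum B -> B = A].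

Lemma minimal_no_unique_sum_exists (G : finZmodType) (A : {set G}) :
  (2 <= #|A|)%N -> no_unique_sum A ->
  exists2 B : {set G}, B \subset A & minimal_no_unique_sum B.
Proof.
move=> A2 nA; pose P (B : {set G}) := `[< (2 <= #|B|)%N /\ no_unique_sum B >].
have PA : P A by apply/asboolP.
have [B /minsetP[/asboolP[B2 nB] minB] BA] := minset_exists PA.
exists B => //; split => // C CB C2 nC; apply: minB => //.
exact/asboolP.
Qed.

(** If [a] and [b] maximise [h] on [A], so do both terms of [rel (a, b)]. Hence the maximum level
    set [F] has no unique sum, and minimality gives [F = A]. *)
Lemma minimal_solution_constant (G : finZmodType) (A : {set G})
    (rel : G * G -> G * G) (h : G -> rat) :
  minimal_no_unique_sum A ->
  (forall a b, a \in A -> b \in A ->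
     [/\ (rel (a, b)).1 \in A, (rel (a, b)).2 \in A,
         a + b = (rel (a, b)).1 + (rel (a, b)).2,
         ~ ((a = (rel (a, b)).1 /\ b = (rel (a, b)).2) \/
            (a = (rel (a, b)).2 /\ b = (rel (a, b)).1)) &
         h a + h b = h (rel (a, b)).1 + h (rel (a, b)).2]) ->
  forall a b, a \in A -> b \in A -> h a = h b.
Proof.
move=> [A2 nA minA] relA.
have [a0 a0A] : exists a, a \in A by apply/card_gt0P; apply: leq_trans A2.
pose t := [arg max_(a > a0 in A) h a]%O.
have [tA ht] : t \in A /\ forall a, a \in A -> h a <= h t.
  by rewrite /t; case: arg_maxP => // i iA hi; split => // a /hi.
pose F := [set a in A | h a == h t].
have FP a : a \in F -> a \in A /\ h a = h t by rewrite inE => /andP[-> /eqP].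
have relF a b : a \in F -> b \in F -> (rel (a, b)).1 \in F /\ (rel (a, b)).2 \in F.
  move=> /FP[aA ha] /FP[bA hb]; have [cA dA _ _] := relA a b aA bA.
  by rewrite !inE cA dA /= ha hb => e; have := ht _ cA; have := ht _ dA; lra.
have tF : t \in F by rewrite inE tA eqxx.
have FA : F = A.
  apply: minA; first by apply/subsetP => a /FP[].
    (* The chosen representation of [t + t] is not [(t, t)], so it provides a second point of
       [F]. *)
    have [cF dF] := relF t t tF tF.
    have [_ _ _ ne _] := relA t t tA tA.
    apply/card_gt1P; case: (eqVneq t (rel (t, t)).1) => [ct|ct].
      exists t, (rel (t, t)).2; split=> //; apply/eqP => dt; apply: ne; left.
      by rewrite -ct -dt.
    by exists t, (rel (t, t)).1.
  move=> a b aF bF; have [cF dF] := relF a b aF bF.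
  have [[aA _] [bA _]] := (FP a aF, FP b bF).
  have [_ _ e ne _] := relA a b aA bA.
  by exists (rel (a, b)).1, (rel (a, b)).2.
by move=> a b; rewrite -FA => /FP[_ ->] /FP[_ ->].
Qed.

(** The equations in generator coordinates vanish at the generators modulo [p], while their rational
    row space contains [vec a0 - vec a1] for distinct [a0], [a1] in [A]. So a nonzero minor [D]
    satisfies [D (a0 - a1) = 0] modulo [p], and [p] divides [D]. *)
Lemma prime_le_of_combinations (p : nat) (A S : {set 'Z_p}) (L : nat) :
  prime p -> minimal_no_unique_sum A -> (0 < L)%N ->
  (forall a, a \in A -> combination S L a) -> (p <= (4 * L) ^ #|S|)%N.
Proof.
move=> pr minA L0 combA; have [A2 nA _] := minA.
have /choice[v hv] : forall a : 'Z_p, exists va : 'Z_p -> int, a \in A ->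
    (\sum_(g in S) `|va g| <= L)%N /\ \sum_(g in S) g *~ va g = a.
  move=> a; case: (boolP (a \in A)) => [/combA[va ?]|_]; first by exists va.
  by exists (fun=> 0).
have /choice[rel hrel] : forall ab : 'Z_p * 'Z_p, exists cd : 'Z_p * 'Z_p,
    ab.1 \in A -> ab.2 \in A ->
    [/\ cd.1 \in A, cd.2 \in A, ab.1 + ab.2 = cd.1 + cd.2 &
      ~ ((ab.1 = cd.1 /\ ab.2 = cd.2) \/ (ab.1 = cd.2 /\ ab.2 = cd.1))].
  move=> [a b]; case: (boolP (a \in A)) => aA; last by exists (0, 0).
  case: (boolP (b \in A)) => bA; last by exists (0, 0).
  by have [c [d cd]] := nA a b aA bA; exists (c, d).
pose N := #|S|; pose gen (i : 'I_N) : 'Z_p := enum_val i.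
pose vec a : 'rV[int]_N := \row_i v a (gen i).
pose eqn (ab : 'Z_p * 'Z_p) : 'rV[int]_N :=
  if (ab.1 \in A) && (ab.2 \in A)
  then vec ab.1 + vec ab.2 - vec (rel ab).1 - vec (rel ab).2 else 0.
pose M : 'M[int]_(#|{: 'Z_p * 'Z_p}|, N) := \matrix_(k, i) eqn (enum_val k) 0 i.
pose ev (w : 'rV[int]_N) : 'Z_p := \sum_i gen i *~ w 0 i.
have evD w w' : ev (w + w') = ev w + ev w'.
  by rewrite /ev -big_split /=; apply: eq_bigr => i _; rewrite mxE mulrzDr.
have evN w : ev (- w) = - ev w.
  by rewrite /ev -sumrN; apply: eq_bigr => i _; rewrite mxE mulrNz.
have ev_vec a : a \in A -> ev (vec a) = a.
  move=> aA; rewrite -[RHS](hv a aA).2 big_enum_val /ev.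
  by apply: eq_bigr => i _; rewrite mxE.
have norm_vec a : a \in A -> \sum_i `|vec a 0 i| <= L%:Z.
  move=> aA; have [le _] := hv a aA.
  rewrite big_enum_val in le; rewrite (eq_bigr (fun i => `|v a (gen i)|%N%:Z)); last first.
    by move=> i _; rewrite mxE abszE.
  by rewrite -(big_morph Posz PoszD (erefl _)) lez_nat.
have ev_eqn ab : ev (eqn ab) = 0.
  rewrite /eqn; case: ifP => [/andP[aA bA]|_]; last first.
    by rewrite /ev big1 // => i _; rewrite mxE mulr0z.
  have [cA dA e _] := hrel ab aA bA.
  by rewrite !evD !evN !ev_vec // e -addrA -opprD subrr.
have norm_eqn ab : \sum_i `|eqn ab 0 i| <= (4 * L)%N%:Z.
  rewrite /eqn; case: ifP => [/andP[aA bA]|_]; last first.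
    by rewrite big1 // => i _; rewrite mxE normr0.
  have [cA dA _ _] := hrel ab aA bA.
  have := norm_vec _ aA; have := norm_vec _ bA.
  have := norm_vec _ cA; have := norm_vec _ dA.
  suff : \sum_i `|(vec ab.1 + vec ab.2 - vec (rel ab).1 - vec (rel ab).2) 0 i| <=
     \sum_i `|vec ab.1 0 i| + \sum_i `|vec ab.2 0 i|
     + \sum_i `|vec (rel ab).1 0 i| + \sum_i `|vec (rel ab).2 0 i|.
    by rewrite PoszM => *; lra.
  rewrite -!big_split /=; apply: ler_sum => i _; rewrite !mxE; lia.
have [a0 [a1 [a0A a1A ne]]] : exists a0 a1, [/\ a0 \in A, a1 \in A & a0 != a1].
  by move/card_gt1P: A2 => [x [y [xA yA xy]]]; exists x, y.
(* Row space membership is tested on the cokernel: each of its columns yields a rational solution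
   [h] of all equations, which is constant on [A]. *)
have span : (map_mx intr (vec a0 - vec a1) <= (map_mx intr M : 'M[rat]__))%MS.
  rewrite submxE; apply/eqP/matrixP => i0 j; rewrite ord1 [RHS]mxE {i0}.
  set K := cokermx _.
  pose h a : rat := (map_mx intr (vec a) *m K) 0 j.
  have hD w w' : (map_mx (intr : int -> rat) (w + w') *m K) 0 j =
      (map_mx intr w *m K) 0 j + (map_mx intr w' *m K) 0 j.
    by rewrite map_mxD mulmxDl mxE.
  have hN w : (map_mx (intr : int -> rat) (- w) *m K) 0 j = - (map_mx intr w *m K) 0 j.
    by rewrite map_mxN mulNmx mxE.
  have solve ab : (map_mx (intr : int -> rat) (eqn ab) *m K) 0 j = 0.
    have -> : map_mx (intr : int -> rat) (eqn ab) = row (enum_rank ab) (map_mx intr M).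
      by apply/rowP => i; rewrite !mxE enum_rankK.
    by rewrite -row_mul mulmx_coker !mxE.
  rewrite hD hN; apply/eqP; rewrite subr_eq0; apply/eqP.
  apply: (minimal_solution_constant (rel := rel) (h := h) minA) => // a b aA bA.
  have [cA dA e1 e2] := hrel (a, b) aA bA; split => //.
  have := solve (a, b); rewrite /eqn /= aA bA /= !hD !hN => e.
  by apply/eqP; rewrite -subr_eq0 opprD addrA; apply/eqP.
have L4 : (0 < 4 * L)%N by lia.
have rowM k : \sum_j `|M k j| <= (4 * L)%N%:Z.
  apply: le_trans (norm_eqn (enum_val k)); rewrite le_eqVlt; apply/orP; left.
  by apply/eqP; apply: eq_bigr => j _; rewrite mxE.
have [D [y [D0 DL Dy]]] := int_multiple_in_row_span L4 rowM span.
have evDu : ev (D *: (vec a0 - vec a1)) = (a0 - a1) *~ D.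
  have <- : ev (vec a0 - vec a1) = a0 - a1 by rewrite evD evN !ev_vec.
  rewrite /ev mulrz_suml.
  by apply: eq_bigr => i _; rewrite [in LHS]mxE mulrC mulrzA.
have ev0 : ev (y *m M) = 0.
  have -> : ev (y *m M) = \sum_k ev (eqn (enum_val k)) *~ y 0 k.
    rewrite /ev; under [RHS]eq_bigr => k _ do rewrite mulrz_suml.
    rewrite exchange_big /=; apply: eq_bigr => i _.
    rewrite mxE mulrz_sumr; apply: eq_bigr => k _.
    by rewrite mxE mulrC mulrzA.
  by rewrite big1 // => k _; rewrite ev_eqn mul0rz.
have := Zp_mulrz_eq0 (x := a0 - a1) (z := D) pr.
rewrite -evDu Dy ev0 subr_eq0 => /(_ erefl ne) pD.
by apply: leq_trans DL; apply: dvdn_leq => //; rewrite absz_gt0.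
Qed.

(** * Good elements and popular differences *)

Section Representations.
Variables (G : finZmodType) (A : {set G}).
Implicit Types (a b t : G) (S Z : {set G}).

(** A triple [(b, c, d)] writes [a] as [c + d - b]; the last two conditions exclude the trivial
    equations. *)
Definition sum_triples a : pred (G * G * G) := fun w =>
  [&& w.1.1 \in A, w.1.2 \in A, w.2 \in A, a + w.1.1 == w.1.2 + w.2, w.1.2 != a & w.2 != a].

(* Pairs [(b, b + t)], padded to triples so that one packing lemma serves both kinds. *)
Definition diff_triples t : pred (G * G * G) := fun w =>
  [&& w.1.1 \in A, w.1.2 == w.1.1, w.2 \in A & w.2 == w.1.1 + t].

Definition good M a : bool := `[< packing (sum_triples a) M >].
Definition popular M t : bool := `[< packing (diff_triples t) M >].

Lemma unpopular_count M t :
  ~~ popular M t -> (#|[set b in A | (b + t)%R \in A]| <= 6 * M)%N.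
Proof.
move=> /asboolP unp; case: (packing_or_cover (diff_triples t) M) => // -[H [cH HF]].
have cover : [set b in A | b + t \in A] \subset H :|: [set h - t | h in H].
  apply/subsetP => b; rewrite inE => /andP[bA btA].
  have /HF : diff_triples t (b, b, b + t) by rewrite /diff_triples /= bA btA !eqxx.
  rewrite -setI_eq0 => /set0Pn[x]; rewrite !inE => /andP[/orP[/orP[]|] /eqP -> xH].
  - by rewrite xH.
  - by rewrite xH.
  - by apply/orP; right; apply/imsetP; exists (b + t) => //; rewrite addrK.
apply: leq_trans (subset_leq_card cover) _; apply: leq_trans (leq_card_setU _ _) _.
apply: leq_trans (leq_add cH (leq_trans (leq_imset_card _ _) cH)) _; lia.
Qed.

Definition exceptions M a : {set G} :=
  [set b in A | ~~ [exists h in A, [&& h != a, popular M (a - h) & b + a - h \in A]]].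

(** A set [H] of at most [3 * M] points meets every triple [(b, c, d)]. If [b] is exceptional and
    outside [H], some [h] in [H] among [c], [d] has [a - h] unpopular, which accounts for at most
    [6 * M] values of [b]. In total [3 * M + 18 * M ^ 2] at most. *)
Lemma bad_exceptions M a : no_unique_sum A -> a \in A -> ~~ good M a ->
  (#|exceptions M a| <= 21 * M ^ 2)%N.
Proof.
move=> nA aA /asboolP bad; case: (packing_or_cover (sum_triples a) M) => // -[H [cH HF]].
have cover : exceptions M a \subset H :|:
    \bigcup_(h in H | ~~ popular M (a - h)) [set b in A | b + (a - h) \in A].
  apply/subsetP => b; rewrite inE => /andP[bA /existsPn exc].
  have [c [d [cA dA e ne]]] := nA a b aA bA.
  have ca : c != a.
    apply/eqP => ca; apply: ne; left; split=> //.
    by move: e; rewrite ca => /addrI.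
  have da : d != a.
    apply/eqP => da; apply: ne; right; split=> //.
    by move: e; rewrite da addrC => /addIr.
  have /HF : sum_triples a (b, c, d) by rewrite /sum_triples /= bA cA dA e eqxx ca da.
  have via h k : h \in H -> h \in A -> k \in A -> h != a -> a + b = h + k ->
      b \in H :|: \bigcup_(h in H | ~~ popular M (a - h)) [set b in A | b + (a - h) \in A].
    move=> hH hA kA ha ehk; rewrite inE; apply/orP; right; apply/bigcupP.
    have kE : b + (a - h) = k by rewrite addrA (addrC b) ehk addrAC subrr add0r.
    exists h; last by rewrite inE bA kE.
    rewrite hH; move: (exc h); rewrite hA ha -addrA kE kA andbT /=; exact.
  rewrite -setI_eq0 => /set0Pn[x]; rewrite !in_setI !inE.
  move=> /andP[/orP[/orP[]|] /eqP -> xH].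
  - by rewrite xH.
  - by have := via c d xH cA dA ca e; rewrite inE.
  - by have := via d c xH dA cA da; rewrite addrC (addrC d) inE addrC; apply.
apply: leq_trans (subset_leq_card cover) _; apply: leq_trans (leq_card_setU _ _) _.
have le : (#|\bigcup_(h in H | ~~ popular M (a - h)%R) [set b in A | (b + (a - h))%R \in A]|
    <= #|H| * (6 * M))%N.
  apply: leq_trans (card_bigcup_le_sum _ _) _.
  rewrite -sum_nat_const big_mkcondr /=; apply: leq_sum => h _.
  by case: ifP => // /unpopular_count.
case: M cH le {cover bad HF} => [|M]; nia.
Qed.

(** Sums and differences each get their own colour class, hence the factor 2 in the size; the norms
    3 and 2 are those of [c + d - b] and [d - b]. *)
Lemma sampling q M : (0 < q)%N -> (0 < M)%N ->
  (q * #|A| ^ 2 * (q ^ 3 - 1) ^ M < (q ^ 3) ^ M)%N ->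
  exists S : {set G}, [/\ (q * #|S| <= 2 * #|A|)%N,
    forall a, good M a -> a \in A -> combination S 3 a &
    forall t, popular M t -> combination S 2 t].
Proof.
move=> q0 M0 small.
have small_le (J : {set G}) : (#|J| <= #|A| ^ 2)%N ->
    (q * #|J| * (q ^ 3 - 1) ^ M < (q ^ 3) ^ M)%N.
  by move=> le; apply: leq_ltn_trans small; rewrite leq_mul2r leq_mul2l le !orbT.
have sub_sum a w : sum_triples a w -> supp w \subset A.
  move=> /and5P[w1 w2 w3 _ _]; apply/subsetP => x.
  by rewrite !inE => /orP[/orP[]|] /eqP ->.
have sub_diff t w : diff_triples t w -> supp w \subset A.
  move=> /and4P[w1 /eqP w2 w3 _]; apply/subsetP => x.
  by rewrite !inE w2 => /orP[/orP[]|] /eqP ->.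
have [] := @exists_dense_colour_class _ A _ [set a in A | good M a] sum_triples q M q0.
- apply: small_le; apply: (@leq_trans #|A|);
    last by rewrite -mulnn; case: #|A| => // n; rewrite leq_pmulr.
  by apply: subset_leq_card; apply/subsetP => a; rewrite inE => /andP[].
- exact: sub_sum.
- by move=> a; rewrite inE => /andP[_ /asboolP].
move=> D1 [cD1 D1P].
have [] := @exists_dense_colour_class _ A _ [set t | popular M t] diff_triples q M q0.
(* Since [M] is positive, every popular [t] is a difference of two elements of [A]. *)
- apply: small_le; have <- : #|setX A A| = (#|A| ^ 2)%N by rewrite cardsX.
  apply: leq_trans (leq_imset_card (fun xy => xy.1 - xy.2) _).
  apply: subset_leq_card; apply/subsetP => t; rewrite inE => /asboolP[[|w s] []] /=.
    by move=> e; move: M0; rewrite -e.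
  move=> _ /andP[/and4P[w1 _ w2 /eqP e] _] _; apply/imsetP; exists (w.2, w.1.1).
    by rewrite in_setX w1 w2.
  by rewrite /= e addrAC subrr add0r.
- exact: sub_diff.
- by move=> t; rewrite inE => /asboolP.
move=> D2 [cD2 D2P].
exists (D1 :|: D2); split.
- apply: leq_trans (leq_mul (leqnn q) (leq_card_setU _ _)) _.
  by rewrite mulnDr mul2n -addnn leq_add.
- move=> a ga aA; have [|w [/and5P[_ _ _ /eqP e _] wD]] := D1P a; first by rewrite inE aA.
  have cw x : x \in supp w -> combination (D1 :|: D2) 1 x.
    by move=> xw; apply: combination_gen; rewrite inE (subsetP wD).
  have -> : a = w.1.2 + w.2 - w.1.1 by rewrite -e addrK.
  by apply: (@combinationB _ _ 2 1); [apply: (@combinationD _ _ 1 1)|];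
    apply: cw; rewrite !inE eqxx ?orbT.
- move=> t pt; have [|w [/and4P[_ _ _ /eqP e] wD]] := D2P t; first by rewrite inE.
  have cw x : x \in supp w -> combination (D1 :|: D2) 1 x.
    by move=> xw; apply: combination_gen; rewrite inE (subsetP wD) ?orbT.
  have -> : t = w.2 - w.1.1 by rewrite e addrAC subrr add0r.
  by apply: (@combinationB _ _ 1 1); apply: cw; rewrite !inE eqxx ?orbT.
Qed.

Lemma combination_to_point (e : rel G) S L K k y z :
  (forall x y, e x y -> combination S L (y - x)) ->
  y \in ball e A k z -> combination S K y -> combination S (K + k * L) z.
Proof.
move=> eL yz cy; rewrite -(subKr y z); apply: combinationB => //.
exact: combination_ball yz.
Qed.

Lemma combination_from_centre (e : rel G) S L K k y z :
  (forall x y, e x y -> combination S L (y - x)) ->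
  y \in ball e A k z -> combination S K z -> combination S (K + k * L) y.
Proof.
move=> eL yz cz; rewrite -(subrKC z y); apply: combinationD => //.
exact: combination_ball yz.
Qed.

Lemma combination_dominated (e : rel G) S (Y : {set G}) K k :
  (0 < K)%N ->
  (forall x y, e x y -> combination S 2 (y - x)) ->
  (forall y, y \in Y -> y \in A -> combination S K y) ->
  (forall C : {set G}, C \subset A -> C != set0 -> (#|C| <= k)%N -> out_closed e A C ->
     exists2 y, y \in C & y \in Y) ->
  exists Z : {set G}, (k * #|Z| <= #|A|)%N /\
    forall a, a \in A -> combination (S :|: Z) (K + 4 * k) a.
Proof.
move=> K0 eS YS small; have [Z [ZA cZ domZ]] := dominating_set small.
have gen z : z \in Z -> combination (S :|: Z) K z.
  by move=> zZ; apply: (combination_le K0); apply: combination_gen; rewrite inE zZ orbT.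
have eS' x y : e x y -> combination (S :|: Z) 2 (y - x).
  by move=> /eS; apply: combination_subset; exact: subsetUl.
exists Z; split=> // a aA; have [y ya yYZ] := domZ a aA.
(* Walks from [a] and from a centre [z] meet at [y]; each has at most [k] steps of norm 2. *)
have -> : (K + 4 * k = (K + k * 2) + k * 2)%N by lia.
apply: (combination_to_point eS' ya); case: yYZ => [yY|[z /gen cz yz]].
  have yA := subsetP (ball_sub e k aA) _ ya.
  by apply: combination_le (leq_addr _ _) (combination_subset (subsetUl _ _) (YS _ yY yA)).
exact: combination_from_centre eS' yz cz.
Qed.

End Representations.

(** * Walks in small sets *)

Lemma val_Zp_mulrn (p : nat) (x : 'Z_p) (n : nat) :
  (1 < p)%N -> val (x *+ n) = (x * n %% p)%N.
Proof. by move=> p1; rewrite Zp_mulrn /= [X in (_ %% X)%N]Zp_cast. Qed.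

(** Pigeonhole: the [p] multipliers fall into [Q ^ #|C|] boxes, according to which of [Q] equal
    intervals contains each residue; [mu] is the difference of two multipliers sharing a box. *)
Lemma dirichlet_Zp (p Q : nat) (C : {set 'Z_p}) :
  prime p -> (0 < Q)%N -> (Q ^ #|C| < p)%N ->
  exists (mu : nat) (u : 'Z_p -> int), ~~ (p %| mu)%N /\
    forall c, c \in C -> c *+ mu = (u c)%:~R /\ (Q * `|u c| < p)%N.
Proof.
move=> pr Q0 small; have p1 := prime_gt1 pr; have p0 := prime_gt0 pr.
pose r (l : 'I_p) (c : 'Z_p) : nat := (c * l %% p)%N.
have rQ l c : (r l c * Q %/ p < Q)%N.
  by rewrite ltn_divLR // mulnC ltn_pmul2l // ltn_mod.
pose box (l : 'I_p) : {ffun 'I_#|C| -> 'I_Q} := [ffun i => Ordinal (rQ l (enum_val i))].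
have /injectivePn[l1 [l2 ne e]] : ~~ injectiveb box.
  apply/negP => /injectiveP/leq_card; rewrite card_ffun !card_ord.
  by rewrite leqNgt small.
wlog lt : l1 l2 ne e / (l2 < l1)%N.
  move=> H; case: (ltngtP l1 l2) => [lt|lt|eq].
  - by apply: (H l2 l1); rewrite // eq_sym.
  - exact: (H l1 l2).
  - by case/eqP: ne; apply: val_inj.
exists (l1 - l2)%N, (fun c => (r l1 c)%:Z - (r l2 c)%:Z); split.
  by rewrite gtnNdvd ?subn_gt0 //; apply: leq_ltn_trans (leq_subr _ _) (ltn_ord l1).
move=> c cC; split.
  have rE (l : 'I_p) : c *+ l = (r l c)%:R.
    by apply: val_inj; rewrite val_Zp_mulrn // [RHS]val_Zp_nat // /r modn_mod.
  by rewrite mulrnBr ?(ltnW lt) // !rE rmorphB.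
have := congr1 (fun f : {ffun _ -> 'I_Q} => val (f (enum_rank_in cC c))) e.
rewrite !ffunE /= enum_rankK_in //.
move: (r l1 c) (r l2 c) => x y exy.
have := divn_eq (x * Q) p; have := divn_eq (y * Q) p.
have := ltn_pmod (x * Q) p0; have := ltn_pmod (y * Q) p0.
rewrite exy; move: (_ %/ _)%N (_ %% _)%N (_ %% _)%N => k s t.
by move=> *; nia.
Qed.

(** [a] maximises the short lift [u] on [C]. Each step [a - h] lifts to a positive integer below
    [p / k]; a walk confined to [X] would return within [k] steps, with total lift strictly between
    0 and [p] yet divisible by [p]. *)
Lemma no_closed_walk (p k : nat) (C : {set 'Z_p}) :
  prime p -> C != set0 -> (#|C| <= k)%N -> ((2 * k) ^ k < p)%N ->
  exists2 a, a \in C & forall X : {set 'Z_p}, X != set0 -> (#|X| <= k)%N ->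
    exists2 b, b \in X & forall h, h \in C -> h != a -> b + a - h \notin X.
Proof.
move=> pr C0 Ck small.
have k0 : (0 < k)%N by apply: leq_trans Ck; rewrite card_gt0.
have small' : ((2 * k) ^ #|C| < p)%N.
  by apply: leq_ltn_trans small; rewrite leq_pexp2l // muln_gt0.
have [|mu [u [pmu uC]]] := dirichlet_Zp pr _ small'; first by rewrite muln_gt0.
have /set0Pn[c0 c0C] := C0.
pose a := [arg max_(c > c0 in C) u c]%O.
have [aC ua] : a \in C /\ forall h, h \in C -> u h <= u a.
  by rewrite /a; case: arg_maxP => // i iC ui; split => // h /ui.
exists a => // X /set0Pn[b0 b0X] Xk; apply: contrapT => none.
have /choice[next nextP] : forall b, exists h, b \in X ->
    [/\ h \in C, h != a & b + a - h \in X].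
  move=> b; apply: contrapT => bad; apply: none; exists b.
    by apply: contrapT => /negP bX; apply: bad; exists 0 => bX'; rewrite bX' in bX.
  move=> h hC ha; apply/negP => hX; apply: bad; exists h; split => //.
pose w b : int := u a - u (next b).
pose walk i := iter i (fun b => b + a - next b) b0.
have walkX i : walk i \in X by elim: i => //= i /nextP[].
(* Both lifts are below [p / (2 * k)] in absolute value; equality of lifts would force [h = a], as
   [p] does not divide [mu]. *)
have wP b : b \in X -> 0 < w b /\ k%:Z * w b < p%:Z.
  move=> /nextP[hC ha _]; have [e1 l1] := uC _ aC; have [e2 l2] := uC _ hC.
  have le := ua _ hC; split; last by rewrite /w; nia.
  rewrite /w subr_gt0 lt_neqAle le andbT; apply: contra pmu => /eqP eu.
  apply: (@Zp_mulrn_eq0 _ (next b - a)) => //; last by rewrite subr_eq0.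
  by rewrite mulrnBl e1 e2 eu subrr.
have walk_diff i j : (walk (i + j)%N - walk i) *+ mu = (\sum_(l < j) w (walk (i + l)%N))%:~R.
  elim: j => [|j IH]; first by rewrite addn0 subrr mul0rn big_ord0.
  rewrite big_ord_recr /= rmorphD /= -IH addnS /=.
  have [hC ha _] := nextP _ (walkX (i + j)%N).
  have -> : (w (walk (i + j)%N))%:~R = (a - next (walk (i + j)%N)) *+ mu.
    by rewrite mulrnBl (uC _ aC).1 (uC _ hC).1 rmorphB.
  rewrite -mulrnDl; congr (_ *+ _); rewrite -/(walk _) -!addrA.
  by congr (_ + _); rewrite addrA [LHS]addrC.
have /injectivePn[i [j ne e]] : ~~ injectiveb (fun i : 'I_k.+1 => walk i).
  apply/negP => /injectiveP inj; move: Xk; apply/negP; rewrite -ltnNge.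
  rewrite -[k.+1]card_ord -(card_imset _ inj); apply: subset_leq_card.
  by apply/subsetP => _ /imsetP[i _ ->].
wlog lt : i j ne e / (i < j)%N.
  move=> H; case: (ltngtP i j) => [lt|lt|eq].
  - exact: (H i j).
  - by apply: (H j i); rewrite // eq_sym.
  - by case/eqP: ne; apply: val_inj.
have := walk_diff i (j - i)%N; rewrite subnKC ?(ltnW lt) // e subrr mul0rn.
set s := \sum_(l < _) _ => /esym s0.
have sb : (0 < s) && (k%:Z * s < (j - i)%N%:Z * p%:Z).
  rewrite /s; have : (0 < j - i)%N by rewrite subn_gt0.
  elim: (j - i)%N => // d IH _; rewrite big_ord_recr /=.
  have [w1 w2] := wP _ (walkX (i + d)%N).
  case: d IH w1 w2 => [|d] IH w1 w2; first by rewrite big_ord0 add0r mul1r w1 w2.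
  have /andP[] := IH isT; move: (\sum_(l < _) _) (w _) w1 w2 => x y; lia.
have ps : (p %| `|s|)%N.
  apply: (@Zp_mulrz_eq0 _ 1) => //; exact: oner_neq0.
have {sb} [s_gt0 s_lt] := andP sb.
have le : (p <= `|s|)%N by apply: dvdn_leq => //; rewrite absz_gt0 gt_eqF.
have ji : (j - i <= k)%N by have := ltn_ord j; lia.
move: s_lt; rewrite -(gtz0_abs s_gt0) -!PoszM ltz_nat ltnNge => /negP[].
by rewrite (leq_mul ji le).
Qed.

(** * The bound on p in terms of q and M *)

Lemma prime_bound (p : nat) (A : {set 'Z_p}) (q M : nat) :
  prime p -> minimal_no_unique_sum A -> (0 < q)%N -> (0 < M)%N ->
  (q * #|A| ^ 2 * (q ^ 3 - 1) ^ M < (q ^ 3) ^ M)%N ->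
  (q * (21 * M ^ 2) <= #|A|)%N -> (q * q <= #|A|)%N ->
  exists N : nat, (q * N <= 3 * #|A|)%N /\ (p <= (4 * (3 + 4 * q)) ^ N)%N.
Proof.
move=> pr minA q0 M0 smp exc qq; have [_ nA _] := minA.
(* Below the threshold of [no_closed_walk], [N = q] suffices. *)
have [le|big] := leqP p ((2 * q) ^ q).
  exists q; split; first by lia.
  by apply: leq_trans le _; rewrite leq_exp2r //; lia.
have conclude (S Z : {set 'Z_p}) : (q * #|S| <= 2 * #|A|)%N -> (q * #|Z| <= #|A|)%N ->
    (forall a, a \in A -> combination (S :|: Z) (3 + 4 * q) a) ->
    exists N : nat, (q * N <= 3 * #|A|)%N /\ (p <= (4 * (3 + 4 * q)) ^ N)%N.
  move=> cS cZ comb; exists #|S :|: Z|; split; last exact: prime_le_of_combinations comb.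
  apply: leq_trans (leq_mul (leqnn q) (leq_card_setU S Z)) _.
  by rewrite mulnDr mulSn addnC leq_add.
have [cl|/existsNP[C /not_implyP[CA /not_implyP[C0 /not_implyP[Cq /not_implyP[clC noC]]]]]] :=
  pselect (forall C : {set 'Z_p}, C \subset A -> C != set0 -> (#|C| <= q)%N ->
    out_closed (fun x y => popular A M (x - y)) A C ->
    exists2 y, y \in C & y \in [set a in A | good A M a]).
- have [S [cS goodS popS]] := sampling q0 M0 smp.
  have [||Z [cZ comb]] := combination_dominated (S := S) (K := 3) isT _ _ cl.
  + by move=> x y /popS/combinationN; rewrite opprB.
  + by move=> y; rewrite inE => /andP[yA gy] _; exact: goodS.
  exact: conclude cS cZ comb.
- have badC a : a \in C -> ~~ good A M a.
    by move=> aC; apply/negP => ga; apply: noC; exists a => //; rewrite inE ga (subsetP CA).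
  have [a aC walk] := no_closed_walk pr C0 Cq big.
  have aA := subsetP CA _ aC.
  have cE := bad_exceptions nA aA (badC a aC).
  set E := exceptions A M a in cE.
  (* These steps are differences of elements of [C], so [C] itself generates them with norm 2. *)
  pose e : rel 'Z_p := fun x y => [exists h in C, (h != a) && (y == x + a - h)].
  have small (X : {set 'Z_p}) : X \subset A -> X != set0 -> (#|X| <= q)%N ->
      out_closed e A X -> exists2 y, y \in X & y \in E.
    move=> XA X0 Xq clX; have [b bX bnone] := walk X X0 Xq; exists b => //.
    rewrite inE (subsetP XA) //=; apply/existsPn => h.
    apply/negP => /and4P[hA ha ph bA].
    have hC : h \in C by exact: clC aC hA ph.
    have := bnone h hC ha; rewrite (clX b) //.
    by apply/existsP; exists h; rewrite hC ha eqxx.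
  have [||Z [cZ comb]] := combination_dominated (S := C :|: E) (K := 3) isT _ _ small.
  + move=> x y /existsP[h /and3P[hC _ /eqP ->]].
    rewrite addrAC (addrC x) addrK.
    by apply: (@combinationB _ _ 1 1); apply: combination_gen; rewrite inE ?aC ?hC.
  + move=> y yE _; apply: (@combination_le _ _ 1) => //.
    by apply: combination_gen; rewrite inE yE orbT.
  apply: conclude cZ comb.
  apply: leq_trans (leq_mul (leqnn q) (leq_card_setU C E)) _.
  rewrite mulnDr mul2n -addnn leq_add //; first by apply: leq_trans qq; rewrite leq_mul.
  by apply: leq_trans exc; rewrite leq_mul.
Qed.

(** * Logarithmic estimates *)

(** For [2^t <= s < 2^(t+1)] this reduces to [25 + 16 * t <= 2 ^ t], valid from [t = 8], that is
    [s = 256]. *)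
Lemma poly16_le_exp2 (s : nat) : (256 <= s)%N -> (512 * s ^ 16 <= 2 ^ s)%N.
Proof.
move=> s256; pose t := trunc_log 2 s.
have /andP[ts st] : (2 ^ t <= s < 2 ^ t.+1)%N by apply: trunc_log_bounds => //; lia.
have t8 : (8 <= t)%N by rewrite /t -[8%N](@trunc_expnK 2) // leq_trunc_log.
have lin : (25 + 16 * t <= 2 ^ t)%N.
  rewrite -(subnK t8); elim: (t - 8)%N => // d IH; rewrite addSn expnS.
  move: (2 ^ _)%N IH => x; lia.
apply: (@leq_trans (2 ^ (25 + 16 * t))); last by rewrite leq_exp2l //; lia.
have -> : (25 + 16 * t = 9 + t.+1 * 16)%N by lia.
by rewrite expnD expnM leq_mul2l leq_exp2r // ltnW ?orbT.
Qed.

Lemma prime_le_exp4 (p : nat) (A : {set 'Z_p}) :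
  prime p -> minimal_no_unique_sum A -> (p <= 4 ^ #|A|)%N.
Proof.
move=> pr minA; rewrite -[4%N]/(4 * 1)%N.
by apply: (prime_le_of_combinations pr minA) => // a; exact: combination_gen.
Qed.

(** With [q = s^2] and [M = 4 s^7], the failure probability [(1 - 1/q^3)^M <= 2^(-4s)] beats the
    union bound over fewer than [2^(4s)] events, and the exceptions cost [q * 21 M^2 = 336 s^16],
    which is at most [2^s]. *)
Lemma prime_le_exp2 (p : nat) (A : {set 'Z_p}) (s : nat) :
  prime p -> minimal_no_unique_sum A ->
  (256 <= s)%N -> (2 ^ s <= #|A| < 2 ^ s.+1)%N ->
  exists N : nat, (s ^ 2 * N <= 3 * #|A|)%N /\ (p <= 2 ^ (s * N))%N.
Proof.
move=> pr minA s256 /andP[sn ns]; have big := poly16_le_exp2 s256.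
have s0 : (0 < s)%N by lia.
have pw i : (i <= 16)%N -> (s ^ i <= s ^ 16)%N by move=> ?; rewrite leq_pexp2l.
pose q := (s ^ 2)%N; pose Q := (q ^ 3)%N; pose M := (Q * (4 * s))%N.
have q0 : (0 < q)%N by rewrite expn_gt0 s0.
have Q2 : (2 <= Q)%N.
  rewrite /Q /q -expnM; apply: (@leq_trans (s ^ 1)); last by rewrite leq_pexp2l.
  by rewrite expn1; lia.
have M0 : (0 < M)%N by rewrite muln_gt0 (ltnW Q2) muln_gt0.
have [|||N [qN pN]] := prime_bound (q := q) pr minA q0 M0.
- have n2 : (q * #|A| ^ 2 < 2 ^ (4 * s))%N.
    apply: (@leq_trans (q * (2 ^ s.+1) ^ 2)).
      by rewrite ltn_pmul2l // ltn_exp2r.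
    have -> : (2 ^ (4 * s) = 2 ^ s * 2 ^ s * (2 ^ s) ^ 2)%N.
      by rewrite -!expnM -!expnD; congr (_ ^ _)%N; lia.
    rewrite (expnS 2 s) expnMn mulnA leq_mul2r; apply/orP; right.
    have x0 : (0 < 2 ^ s)%N by rewrite expn_gt0.
    apply: leq_trans (leq_pmulr _ x0); apply: leq_trans big.
    by rewrite mulnC leq_mul // pw.
  apply: leq_trans (exp_pred_double (4 * s) (_ : 0 < Q)%N); last by lia.
  by rewrite ltn_pmul2r // expn_gt0 subn_gt0 Q2.
- apply: leq_trans sn; apply: leq_trans big.
  have -> : (q * (21 * M ^ 2) = 336 * s ^ 16)%N.
    by rewrite /M /Q /q; ring.
  by rewrite leq_mul2r orbC.
- apply: leq_trans sn; apply: leq_trans big; rewrite -expnD.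
  by apply: leq_trans (pw _ _) _; rewrite ?leq_pmull.
exists N; split => //; apply: leq_trans pN _; rewrite expnM.
case: (posnP N) => [->//|N0]; rewrite leq_exp2r //.
have := pw 2%N isT; rewrite /q; have : (0 < s ^ 2)%N by []. lia.
Qed.

Section Logarithms.
Variable R : realType.

Lemma ln_le_exp2 (x : R) (k : nat) : 0 < x -> x <= 2 ^+ k -> ln x <= k%:R.
Proof.
move=> x0 xk; apply: (@le_trans _ _ (ln (2 ^+ k))).
  by rewrite ler_ln ?posrE ?exprn_gt0.
rewrite lnXn // ler_wMn2r //.
by have := @le_ln1Dx R 1; rewrite -natr1; apply; lra.
Qed.

(** For [s >= 256] the bounds [ln p <= s N], [ln (ln p) <= s + 2] and [s^2 N <= 3 n] suffice. For
    smaller [s], [ln p <= 2 n] and [s + 2 <= 258] give the constant [516 = 2 * 258]. *)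
Lemma ln_lnln_le (p : nat) (A : {set 'Z_p}) :
  prime p -> minimal_no_unique_sum A ->
  ln (p%:R : R) * ln (ln (p%:R : R)) <= 516 * #|A|%:R.
Proof.
move=> pr minA; have p1 := prime_gt1 pr; have [A2 _ _] := minA.
set n := #|A| in A2 *; pose s := trunc_log 2 n.
have /andP[sn ns] : (2 ^ s <= n < 2 ^ s.+1)%N by apply: trunc_log_bounds => //; lia.
have X0 : 0 < ln (p%:R : R) by rewrite ln_gt0 // ltr1n.
have pR : 0 < p%:R :> R by rewrite ltr0n; lia.
have Xk k : (p <= 2 ^ k)%N -> ln (p%:R : R) <= k%:R.
  by move=> pk; apply: ln_le_exp2 => //; rewrite -natrX ler_nat.
have X2n : ln (p%:R : R) <= (2 * n)%:R.
  by apply: Xk; rewrite expnM; exact: prime_le_exp4.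
have Ys : ln (ln (p%:R : R)) <= (s.+2)%:R.
  apply: ln_le_exp2 => //; apply: le_trans X2n _.
  by rewrite -natrX ler_nat expnS leq_mul2l ltnW.
have n0 : 0 <= n%:R :> R by [].
apply: le_trans (ler_wpM2l (ltW X0) Ys) _.
have [s256|s256] := ltnP s 256.
  apply: (@le_trans _ _ ((2 * n)%:R * 258%:R)).
    by apply: ler_pM => //; [exact: ltW | rewrite ler_nat; lia].
  by rewrite natrM; lra.
have [N [sN pN]] := prime_le_exp2 pr minA s256 (introT andP (conj sn ns)).
apply: (@le_trans _ _ ((s * N)%:R * s.+2%:R)).
  by rewrite ler_wpM2r // Xk.
rewrite -natrM -[516]/(516%:R) -natrM ler_nat.
move: sN; rewrite -/n -mulnn; nia.
Qed.

Lemma c_star_bounds : 0 < c_star R /\ c_star R * 516 <= 1.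
Proof.
rewrite /c_star; set D := (X in 1 / X).
have DE : 516 <= D.
  have h k : 1 <= (10 : R) ^+ k by rewrite exprn_ege1 // ler1n.
  rewrite /D; move: (h 18) (h 9) (h 6) (h 3).
  (* The powers of ten become unknowns that are at least 1; the coefficients already sum to 744. *)
  move: (10 ^+ 18 : R) (10 ^+ 9 : R) (10 ^+ 6 : R) (10 ^+ 3 : R) => *; lra.
have D0 : 0 < D by lra.
by rewrite div1r invr_gt0 D0 mulrC ler_pdivrMr // mul1r.
Qed.

End Logarithms.

Theorem theorem1p1 (R : realType) :
  (forall (p : nat) (A : {set 'Z_p}),
     prime p -> (2 <= #|A|)%N -> no_unique_sum A ->
     c_star R * ln (p%:R : R) * ln (ln (p%:R : R)) <= (#|A|%:R : R))
  /\
  (exists c : R, 0 < c /\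
     forall p : nat, prime p -> odd p ->
       c * ln (p%:R : R) * ln (ln (p%:R : R)) <= ((m p)%:R : R)).
Proof.
have [c0 c1] := c_star_bounds R.
have main (p : nat) (A : {set 'Z_p}) : prime p -> (2 <= #|A|)%N -> no_unique_sum A ->
    c_star R * ln (p%:R : R) * ln (ln (p%:R : R)) <= (#|A|%:R : R).
  (* A lower bound on the size of a minimal subset [B] bounds [#|A|] too. *)
  move=> pr A2 nA; have [B BA minB] := minimal_no_unique_sum_exists A2 nA.
  apply: (@le_trans _ _ #|B|%:R); last by rewrite ler_nat subset_leq_card.
  rewrite -mulrA; apply: le_trans (ler_wpM2l (ltW c0) (ln_lnln_le R pr minB)) _.
  by rewrite mulrA -[leRHS]mul1r ler_wpM2r.
split=> //; exists (c_star R); split=> // p pr odd_p.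
have p2 : (2 < p)%N by apply: odd_prime_gt2.
have [[A [A2 nA] <-] _] := m_minimum p2.
exact: main.
Qed.
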